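(* Let $L(\Lambda)$ be a standard $\tilde{\mathfrak g}$-module of level $k$ with highest weight vector $v_\Lambda=v_{p_1}\otimes\cdots\otimes v_{p_k}$, where $p_1,\dots,p_k\in\{0,\dots,\ell\}$ and $v_{p_j}$ is the highest weight vector of the level $1$ standard module $L(\Lambda_{p_j})$ (so that $\Lambda=\Lambda_{p_1}+\cdots+\Lambda_{p_k}$). If a monomial $x(\pi)\in S(\tilde{\mathfrak g}_1^-)$ satisfies difference and initial conditions on $L(\Lambda)$, then there exists a factorization into monomials of $S(\tilde{\mathfrak g}_1^-)$ $$x(\pi)=x(\pi^{(1)})\cdots x(\pi^{(k)})$$ such that, for each $j=1,\dots,k$, the monomial $x(\pi^{(j)})$ satisfies difference and initial conditions on $L(\Lambda_{p_j})$.
   Context: Let $\ell\in\mathbb N$, $\mathfrak g=\mathfrak{sl}(\ell+1,\mathbb C)$ with Cartan subalgebra $\mathfrak h$, simple roots $\alpha_1,\dots,\alpha_\ell$, and form $\langle x,y\rangle=\mathrm{tr}\,xy$. Fix $m\in\{1,\dots,\ell\}$ and put $\gamma_{ij}=\alpha_i+\cdots+\alpha_m+\cdots+\alpha_j$ and $\Gamma=\{\gamma_{ij}: 1\le i\le m\le j\le \ell\}$ (the set of colors). Fix root vectors $x_\alpha\in\mathfrak g_\alpha$. Let $\tilde{\mathfrak g}=\mathfrak g\otimes\mathbb C[t,t^{-1}]\oplus\mathbb Cc\oplus\mathbb Cd$ be the affine Lie algebra of type $A_\ell^{(1)}$, $x(n)=x\otimes t^n$, with fundamental weights $\Lambda_0,\dots,\Lambda_\ell$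 ($\Lambda_i(d)=0$). Write $x_{ij}(-r)=x_{\gamma_{ij}}(-r)$. The commutative Lie algebra $\tilde{\mathfrak g}_1^-$ has basis $\{x_{ij}(-r): 1\le i\le m\le j\le\ell,\ r\ge1\}$, and $S(\tilde{\mathfrak g}_1^-)$ is its symmetric algebra, i.e. the polynomial algebra in these variables. A monomial $x(\pi)$ is identified with the function $\pi$ assigning to each variable its exponent; put $a_{ij}^r=\pi(x_{ij}(-r))$. A standard module $L(\Lambda)$ is the irreducible highest weight $\tilde{\mathfrak g}$-module with $\Lambda=k_0\Lambda_0+\cdots+k_\ell\Lambda_\ell$, $k_i\in\mathbb Z_{\ge0}$; its level is $k=k_0+\cdots+k_\ell$. It is realized inside a tensor product of $k$ level $1$ modules, with $v_\Lambda$ the tensor product of their highest weight vectors. Difference conditions on $L(\Lambda)$ (level $k$): $x(\pi)$ satisfies them if $$\sum_{\nu=1}^{s}a^{r+1}_{i_\nu j_{s+1-\nu}}+\sum_{\nu=s+1}^{t}a^{r}_{i_\nu j_{t+s+1-\nu}}\le k$$ for all $r\ge1$, all $t\ge1$, $0\le s\le t$, all $1\le i_1\le\cdots\le i_t\le m$ and $\ell\ge j_1\ge\cdots\ge j_t\ge m$ such that the colors $\gamma_{i_1j_s},\gamma_{i_2j_{s-1}},\dots,\gamma_{i_sj_1}$ are distinct and the colors $\gamma_{i_{s+1}j_t},\dots,\gamma_{i_tj_{s+1}}$ are distinct. Initial conditions on $L(\Lambda)$: $x(\pi)$ satisfies them if $$a^1_{i_1j_t}+a^1_{i_2j_{t-1}}+\cdots+a^1_{i_tj_1}\le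 k_0+k_1+\cdots+k_{i_t-1}+k_{j_t+1}+\cdots+k_\ell$$ for all $t\ge1$, $1\le i_1\le\cdots\le i_t\le m$, $\ell\ge j_1\ge\cdots\ge j_t\ge m$ such that the colors $\gamma_{i_1j_t},\dots,\gamma_{i_tj_1}$ are distinct. For $L(\Lambda_i)$ these conditions are taken with $k=1$, $k_i=1$ and $k_{i'}=0$ for $i'\ne i$. *)

(* Defs.v *)
From mathcomp Require Import all_boot all_order all_algebra.
From mathcomp Require Import finmap reals complex monalg.

Set Implicit Arguments.
Unset Strict Implicit.
Unset Printing Implicit Defensive.

Import GRing.Theory.
Local Open Scope ring_scope.

(* Throughout, l is the rank of sl(l+1, C), and the indices i, j of simple
   roots and colors are natural numbers counted from 1, whereas the nodes of
   the affine diagram A_l^(1) are the elements 0, ..., l of 'I_l.+1. *)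

(* Simple root alpha_k = eps_k - eps_(k+1) of sl(l+1, C), for 1 <= k <= l, in
   the coordinates eps_1, ..., eps_(l+1), which are the columns 0, ..., l. *)
Definition simple_root (l k : nat) : 'rV[int]_l.+1 :=
  delta_mx ord0 (inord k.-1) - delta_mx ord0 (inord k).

Definition color (l i j : nat) : 'rV[int]_l.+1 :=
  \sum_(i <= k < j.+1) simple_root l k.

(* The triple (i, j, r) stands for the basis element x_ij(-r) of g_1^-. *)
Definition is_generator (l m : nat) (x : nat * nat * nat) : bool :=
  let: (i, j, r) := x in
  [&& (0 < i)%N, (i <= m)%N, (m <= j)%N, (j <= l)%N & (0 < r)%N].

Definition generator (l m : nat) := {x : nat * nat * nat | is_generator l m x}.

(* A monomial, as the finitely supported function giving the exponents. *)
Definition monomial (l m : nat) := {cmonom (generator l m)}.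

(* S(g_1^-), the complex polynomial algebra in the variables x_ij(-r). *)
Definition sym_algebra (R : realType) (l m : nat) := {malg R[i][monomial l m]}.

Definition x_monomial (R : realType) (l m : nat) (pi : monomial l m) :
  sym_algebra R l m := << pi >>.

(* a_ij^r = pi(x_ij(-r)); the default value 0 is only reached by triples that
   are not generators. *)
Definition expo (l m : nat) (pi : monomial l m) (i j r : nat) : nat :=
  if (insub (i, j, r) : option (generator l m)) is Some x then pi x else 0%N.

(* A dominant integral weight k_0 Lambda_0 + ... + k_l Lambda_l, given by its
   coefficients k_0, ..., k_l. It stands for the standard module L(Lambda),
   whose difference and initial conditions depend on these numbers only. *)
Definition dominant_weight (l : nat) := {ffun 'I_l.+1 -> nat}.

Definition fundamental_weight (l : nat) (p : 'I_l.+1) : dominant_weight l :=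
  [ffun q => (q == p : nat)].

Definition level (l : nat) (Lam : dominant_weight l) : nat :=
  (\sum_(q < l.+1) Lam q)%N.

(* 1 <= i_1 <= ... <= i_t <= m and l >= j_1 >= ... >= j_t >= m; only the values
   of i and j at 1, ..., t are relevant. *)
Definition admissible_indices (l m t : nat) (i j : nat -> nat) : Prop :=
  (forall nu, (1 <= nu <= t)%N ->
     (1 <= i nu <= m)%N /\ (m <= j nu <= l)%N) /\
  (forall mu nu, (1 <= mu)%N -> (mu <= nu)%N -> (nu <= t)%N ->
     (i mu <= i nu)%N /\ (j nu <= j mu)%N).

Definition difference_conditions (l m : nat) (Lam : dominant_weight l)
    (pi : monomial l m) : Prop :=
  forall (r t s : nat) (i j : nat -> nat),
    (1 <= r)%N -> (1 <= t)%N -> (s <= t)%N ->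
    admissible_indices l m t i j ->
    uniq [seq color l (i nu) (j (s + 1 - nu)%N) | nu <- index_iota 1 s.+1] ->
    uniq [seq color l (i nu) (j (t + s + 1 - nu)%N)
         | nu <- index_iota s.+1 t.+1] ->
    (\sum_(1 <= nu < s.+1) expo pi (i nu) (j (s + 1 - nu)) r.+1
     + \sum_(s.+1 <= nu < t.+1) expo pi (i nu) (j (t + s + 1 - nu)) r
     <= level Lam)%N.

Definition initial_conditions (l m : nat) (Lam : dominant_weight l)
    (pi : monomial l m) : Prop :=
  forall (t : nat) (i j : nat -> nat),
    (1 <= t)%N ->
    admissible_indices l m t i j ->
    uniq [seq color l (i nu) (j (t + 1 - nu)%N) | nu <- index_iota 1 t.+1] ->
    (\sum_(1 <= nu < t.+1) expo pi (i nu) (j (t + 1 - nu)) 1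
     <= \sum_(q < l.+1 | q < i t) Lam q + \sum_(q < l.+1 | j t < q) Lam q)%N.

(* Main.v *)
Require Import Defs.
From mathcomp Require Import all_boot all_order all_algebra.
From mathcomp Require Import finmap reals complex monalg zify.

(** Which variables x_ij(-r) can occur together on the left-hand side of a
    difference condition? Two variables of the same degree r can iff their index
    pairs are comparable in the product order, x_ij(-r-1) and x_i'j'(-r) can iff
    i <= i' and j >= j', and variables whose degrees differ by two or more
    cannot. The key observation is that the complementary relation, oriented as
    in [precedes], is transitive ([precedes_trans]). So the sets of variables on
    the left-hand sides are the finite nonempty antichains of a strict partial
    order.

    The initial conditions are difference conditions in disguise. To every
    factor v_q of the highest weight vector attach a fictitious variable of
    degree 0, placed at (q, m) if q <= m and at (m, q) if q >= m. It is
    incomparable to x_ij(-1) exactly when i <= q <= j, and the fictitious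
    variables are pairwise incomparable. The number of them that can be added to
    an antichain in degree 1 with largest first index i and smallest second
    index j is thus the sum of the k_q with i <= q <= j, which is k minus the
    right-hand side of the initial condition.

    So the hypotheses on x(pi) say that in the poset formed by the k fictitious
    variables and the variables of x(pi), the latter repeated according to their
    exponents, every antichain has at most k elements ([antichain_width]). By
    Dilworth's theorem ([dilworth]) this poset is a union of k disjoint chains.
    The fictitious variables form an antichain of size k, so each chain contains
    exactly one of them, and the factor number n of x(pi) is the product of the
    genuine variables in the chain through the fictitious variable of v_(p n).
    An antichain meets a chain at most once: this is the difference conditions
    of level 1 ([chain_difference]), and, as the chain also contains the
    fictitious variable of v_(p n), the initial conditions ([chain_initial]). *)

Set Implicit Arguments.
Unset Strict Implicit.
Unset Printing Implicit Defensive.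

(** * Dilworth's theorem *)

Section Dilworth.

Variables (T : finType) (lt : rel T).
Hypotheses (lt_irr : irreflexive lt) (lt_trans : transitive lt).

Definition antichain (A : {set T}) :=
  [forall x in A, forall y in A, ~~ lt x y].

Definition chain_coloring (P : {set T}) (k : nat) (f : T -> nat) : Prop :=
  {in P, forall x, f x < k} /\
  {in P &, forall x y, f x = f y -> [|| x == y, lt x y | lt y x]}.

Lemma antichainP (A : {set T}) :
  reflect {in A &, forall x y, ~~ lt x y} (antichain A).
Proof.
apply: (iffP forall_inP) => [acA x y xA yA | acA x xA].
  by have /forall_inP := acA x xA; apply.
by apply/forall_inP => y yA; exact: acA.
Qed.

(** An element with the largest number of predecessors is maximal. *)
Lemma exists_maximal (P : pred T) x0 :
  P x0 -> exists2 x, P x & forall y, P y -> ~~ lt x y.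
Proof.
move=> Px0; case: (arg_maxnP (fun x => #|[set z | lt z x]|) Px0) => x Px maxx.
exists x => // y Py; apply/negP => ltxy.
have := maxx y Py; rewrite /= leqNgt; case/negP; apply/proper_card/properP.
split; first by apply/subsetP => z; rewrite !inE => /lt_trans; apply.
by exists x; rewrite !inE ?ltxy ?lt_irr.
Qed.

(** The coloring is injective on an antichain, hence bijective on one with as
    many elements as there are colors. *)
Lemma antichain_meets_chains P k f (B : {set T}) :
  chain_coloring P k f -> B \subset P -> antichain B -> #|B| = k ->
  forall c, c < k -> exists2 y, y \in B & f y = c.
Proof.
move=> [f_lt f_chain] sBP /antichainP acB cardB c ltck.
have insubE x : x \in B -> exists2 u : 'I_k, insub (f x) = Some u & val u = f x.
  move=> xB; case: insubP => [u _ uE | /negP[]]; first by exists u.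
  exact/f_lt/(subsetP sBP).
pose g x : option 'I_k := insub (f x).
have g_inj : {in B &, injective g}.
  move=> x y xB yB; rewrite /g.
  have [u -> uE] := insubE x xB; have [v -> vE] := insubE y yB.
  case=> uv; have fxy : f x = f y by rewrite -uE -vE uv.
  have := f_chain _ _ (subsetP sBP _ xB) (subsetP sBP _ yB) fxy.
  by rewrite (negPf (acB _ _ xB yB)) (negPf (acB _ _ yB xB)) !orbF => /eqP.
have gB : g @: B = [set Some c' | c' in 'I_k].
  apply/eqP; rewrite eqEcard (card_in_imset g_inj) cardB.
  rewrite (card_imset _ (@Some_inj _)) card_ord leqnn andbT; apply/subsetP => _ /imsetP[x xB ->]; rewrite /g.
  by have [u -> _] := insubE x xB; rewrite imset_f.
have : Some (Ordinal ltck) \in g @: B by rewrite gB imset_f.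
case/imsetP => y yB; rewrite /g; have [u -> uE] := insubE y yB.
by case=> uc; exists y => //; rewrite -uE -uc.
Qed.

Lemma chain_coloring_extend (P K : {set T}) k f :
  chain_coloring (P :\: K) k f ->
  {in K &, forall x y, [|| x == y, lt x y | lt y x]} ->
  chain_coloring P k.+1 (fun x => if x \in K then k else f x).
Proof.
move=> [f_lt f_chain] chainK.
have f_ltK x : x \in P -> x \notin K -> f x < k.
  by move=> xP xK; apply: f_lt; rewrite inE xK.
split=> [x xP | x y xP yP].
  by case: ifPn => // xK; rewrite ltnS ltnW // f_ltK.
case: ifPn => xK; case: ifPn => yK fE.
- exact: chainK.
- by have := f_ltK y yP yK; rewrite -fE ltnn.
- by have := f_ltK x xP xK; rewrite fE ltnn.
- by apply: f_chain; rewrite ?inE ?xK ?yK.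
Qed.

(** Galvin's proof, by induction on the number of elements. Let a be maximal and
    cover the rest P' by k chains. If P' has an antichain of size k, take in each
    chain the highest element lying on such an antichain. These k elements form
    an antichain again, so one of them, x, lies below a. Removing a together with
    the part of the chain of x up to x leaves no antichain of size k. If P' has
    none, remove a alone. In both cases the induction hypothesis applies with
    k - 1 colors. *)
Theorem dilworth (k : nat) (P : {set T}) :
  (forall A : {set T}, A \subset P -> antichain A -> #|A| <= k) ->
  exists f, chain_coloring P k f.
Proof.
have [n] := ubnP #|P|; elim: n => // n IHn in k P *; rewrite ltnS => leP width.
have [->|[a0 a0P]] := set_0Vmem P.
  by exists (fun=> 0); split=> x; rewrite inE.
have [a aP maxa] : exists2 a, a \in P & {in P, forall y, ~~ lt a y}.
  by have [a] := exists_maximal a0P; exists a.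
have ac1 x : antichain [set x].
  by apply/antichainP => y z /set1P-> /set1P->; rewrite lt_irr.
have k_gt0 : 0 < k by rewrite (leq_trans _ (width [set a] _ _)) ?cards1 ?sub1set.
pose P' := P :\ a.
have sP'P : P' \subset P := subD1set P a.
have cardP' : #|P'| < n by rewrite (leq_trans _ leP) // (cardsD1 a P) aP.
(* It suffices to find a chain through a that meets all k-antichains. *)
have remove_chain (K : {set T}) : a \in K ->
    {in K &, forall x y, [|| x == y, lt x y | lt y x]} ->
    (forall A : {set T}, A \subset P :\: K -> antichain A -> #|A| <> k) ->
    exists f, chain_coloring P k f.
  move=> aK chainK small.
  have sPK : P :\: K \subset P' by apply: setDS; rewrite sub1set.
  have [A sA acA | f fcol] := IHn k.-1 (P :\: K) (leq_ltn_trans (subset_leq_card sPK) cardP').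
    have := width A (subset_trans sA (subsetDl _ _)) acA.
    rewrite leq_eqVlt => /predU1P[/(small A sA acA) //|ltAk].
    by rewrite -ltnS prednK.
  by rewrite -(prednK k_gt0); exists (fun x => if x \in K then k.-1 else f x);
    apply: chain_coloring_extend.
have width' (A : {set T}) : A \subset P' -> antichain A -> #|A| <= k.
  by move=> sA; apply/width/(subset_trans sA).
have [f fcol] := IHn k _ cardP' width'.
pose full (B : {set T}) := [&& B \subset P', antichain B & #|B| == k].
have [/existsP[B0 fullB0] | /existsPn no_full] := boolP [exists B, full B]; last first.
  apply: (remove_chain [set a]); first exact: set11.
    by move=> x y /set1P-> /set1P->; rewrite eqxx.
  by move=> A sA acA cA; case/negP: (no_full A); rewrite /full sA acA cA eqxx.
pose Q c x := (f x == c) && [exists B, full B && (x \in B)].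
have meets c (B : {set T}) : c < k -> full B -> exists2 y, y \in B & f y = c.
  move=> ltck /and3P[sB acB /eqP cB].
  exact: antichain_meets_chains fcol sB acB cB c ltck.
have top_ex (c : 'I_k) : exists x, Q c x /\ forall y, Q c y -> ~~ lt x y.
  have [y yB0 fy] := meets c B0 (ltn_ord c) fullB0.
  have [|x Qx maxx] := @exists_maximal (Q c) y; last by exists x.
  by rewrite /Q fy eqxx; apply/existsP; exists B0; rewrite fullB0.
have [top topP] := fin_all_exists top_ex.
have topQ (c : 'I_k) : Q c (top c) by have [] := topP c.
have top_full (c : 'I_k) : exists2 B : {set T}, full B & top c \in B.
  by have /andP[_ /existsP[B /andP[]]] := topQ c; exists B.
have top_f (c : 'I_k) : f (top c) = c by have /andP[/eqP] := topQ c.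
have topP' (c : 'I_k) : top c \in P'.
  by have [B /and3P[/subsetP sB _ _] /sB] := top_full c.
have below_top (c : 'I_k) x : x \in P' -> f x = c ->
    [exists B, full B && (x \in B)] -> (x == top c) || lt x (top c).
  move=> xP' fx exB; have [_ fchain] := fcol.
  have /or3P[->//|->|] := fchain x (top c) xP' (topP' c) (etrans fx (esym (top_f c))).
    by rewrite orbT.
  by have [_ maxc] := topP c; rewrite (negPf (maxc _ _)) // /Q fx eqxx.
(* If top c < top d, then a full antichain through top d meets the chain of
   color c at or below top c, so below top d. *)
have top_anti (c d : 'I_k) : ~~ lt (top c) (top d).
  apply/negP => ltcd; have [B fullB dB] := top_full d.
  have [y yB fy] := meets c B (ltn_ord c) fullB.
  have /and3P[/subsetP sB /antichainP acB _] := fullB.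
  have /negP[] := acB y (top d) yB dB.
  have := below_top c y (sB _ yB) fy _.
  case/(_ _)/orP; first by apply/existsP; exists B; rewrite fullB.
    by move/eqP->.
  by move=> /lt_trans; apply.
(* Otherwise a and the k elements top c would form too large an antichain. *)
have [c lt_top_a] : exists c, lt (top c) a.
  apply/existsP; apply/contraT; rewrite negb_exists => /forallP no_lt.
  have aNtop : a \notin [set top c | c in 'I_k].
    by apply/imsetP => -[c _ aE]; have := topP' c; rewrite -aE !inE eqxx.
  have top_inj : injective top by move=> c d cd; apply: val_inj; rewrite /= -(top_f c) -(top_f d) cd.
  suff : #|a |: [set top c | c in 'I_k]| <= k.
    by rewrite cardsU1 aNtop card_imset // card_ord ltnn.
  apply: width.
    rewrite subUset sub1set aP; apply/subsetP => _ /imsetP[c _ ->].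
    exact: subsetP sP'P _ (topP' c).
  apply/antichainP => x y /setU1P[->|/imsetP[c _ ->]] /setU1P[->|/imsetP[d _ ->]].
  - by rewrite lt_irr.
  - by apply/maxa/(subsetP sP'P)/topP'.
  - exact: no_lt.
  - exact: top_anti.
pose K := a |: [set x in P' | (f x == c) && ((x == top c) || lt x (top c))].
apply: (remove_chain K); first exact: setU11.
  have lt_a x : (x == top c) || lt x (top c) -> lt x a.
    by case/predU1P=> [->//|/lt_trans]; apply.
  move=> x y; rewrite !inE => /predU1P[->|/and3P[xP' /eqP fx /lt_a xa]];
    move=> /predU1P[->|/and3P[yP' /eqP fy /lt_a ya]].
  - by rewrite eqxx.
  - by rewrite ya !orbT.
  - by rewrite xa !orbT.
  - have [_ fchain] := fcol; apply: fchain; rewrite ?inE //.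
    by rewrite fx fy.
move=> A sA acA cardA.
have sAP' : A \subset P'.
  by apply: subset_trans sA _; apply: setDS; rewrite sub1set setU11.
have fullA : full A by rewrite /full sAP' acA cardA eqxx.
have [y yA fy] := meets c A (ltn_ord c) fullA.
have := subsetP sA y yA; rewrite inE => /andP[/negP[]].
have yP' := subsetP sAP' y yA.
rewrite /K in_setU1 inE yP' fy eqxx below_top ?orbT //.
by apply/existsP; exists A; rewrite fullA.
Qed.
End Dilworth.

(** * The order on the variables *)

(** Incomparability is the relation of occurring on a common left-hand side of a
    difference condition. *)
Definition precedes (v w : nat * nat * nat) : bool :=
  let: (i, j, r) := v in let: (i', j', r') := w in
  [|| [&& r == r', i < i' & j' < j], (r' == r.+1) && ((i < i') || (j' < j))
    | r.+1 < r'].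

Lemma precedes_irr : irreflexive precedes.
Proof. by case=> -[i j] r; rewrite /precedes; lia. Qed.

(** Two steps that together raise the degree by at most one involve either only
    inequalities in the same direction or, for the step in degree, a
    disjunction one of whose sides is strengthened by the other step. Triples
    whose degrees differ by two or more are always comparable. *)
Lemma precedes_trans : transitive precedes.
Proof. by move=> [[i j] r] [[i' j'] r'] [[i'' j''] r'']; rewrite /precedes; lia. Qed.

Definition incomparable (V : seq (nat * nat * nat)) :=
  {in V &, forall v w, ~~ precedes v w}.

(** Chosen in degree 0 so that a generator (i, j, 1) is incomparable to it iff
    i <= q <= j. *)
Definition fictitious (m q : nat) : nat * nat * nat := (minn q m, maxn q m, 0).

(** * Index sequences and incomparable triples *)

Definition grid_le (a b : nat * nat) := (a.1 <= b.1) && (a.2 <= b.2).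

(** When degrees r + 1 (for a) and r (for b) may occur together. *)
Definition cross (a b : nat * nat) := (a.1 <= b.1) && (b.2 <= a.2).

Definition in_grid (l m : nat) (a : nat * nat) :=
  (1 <= a.1 <= m) && (m <= a.2 <= l).

Lemma grid_le_trans : transitive grid_le.
Proof. by move=> a b c; rewrite /grid_le; lia. Qed.

(** Let i run through the first coordinates of L1 and then of L0, and j through
    the second coordinates of L1 backwards and then of L0 backwards. The first
    sequence increases and the second decreases because both lists are chains
    and [cross] holds between them. *)
Lemma staircase_indices l m (L1 L0 : seq (nat * nat))
  (s := size L1) (t := size L1 + size L0) :
  {in L1 ++ L0, forall a, in_grid l m a} ->
  pairwise grid_le L1 -> pairwise grid_le L0 ->
  allrel cross L1 L0 ->
  exists i j, [/\ admissible_indices l m t i j,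
    [seq (i nu, j (s + 1 - nu)) | nu <- index_iota 1 s.+1] = L1
  & [seq (i nu, j (t + s + 1 - nu)) | nu <- index_iota s.+1 t.+1] = L0].
Proof.
move=> range pw1 pw0 pw10.
pose I := [seq a.1 | a <- L1 ++ L0]; pose J := [seq a.2 | a <- rev L1 ++ rev L0].
have szI : size I = t by rewrite size_map size_cat.
have szJ : size J = t by rewrite size_map size_cat !size_rev.
exists (fun nu => nth 0 I nu.-1), (fun nu => nth 0 J nu.-1); split.
- have pwI : pairwise leq I.
    rewrite pairwise_map pairwise_cat; apply/and3P; split.
    + by apply: sub_allrel pw10 => a b /andP[].
    + by apply: sub_pairwise pw1 => a b /andP[].
    + by apply: sub_pairwise pw0 => a b /andP[].
  have pwJ : pairwise geq J.
    have geq_trans : transitive geq by move=> a b c /= ba cb; apply: leq_trans ba.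
    have pwr L : pairwise grid_le L -> pairwise (relpre snd geq) (rev L).
      move=> pwL; rewrite -pairwise_map -(sorted_pairwise geq_trans) map_rev rev_sorted.
      rewrite (sorted_pairwise leq_trans) pairwise_map.
      by apply: sub_pairwise pwL => a b /andP[].
    rewrite pairwise_map pairwise_cat allrel_rev2 !pwr // !andbT.
    by apply: sub_allrel pw10 => a b /andP[].
  split=> [nu nut | mu nu mu1 munu nut].
    have nuS : nu.-1 < t by lia.
    have /mapP[a aI ->] : nth 0 I nu.-1 \in I by rewrite mem_nth ?szI.
    have /mapP[b bJ ->] : nth 0 J nu.-1 \in J by rewrite mem_nth ?szJ.
    have /andP[ia _] := range a aI.
    by have /andP[] : in_grid l m b by apply: range; move: bJ; rewrite !mem_cat !mem_rev.
  move: munu; rewrite leq_eqVlt => /predU1P[->//|munu].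
  by split; [apply: (pairwiseP 0 pwI) | apply: (pairwiseP 0 pwJ)]; rewrite ?inE ?szI ?szJ; lia.
- apply: (@eq_from_nth _ (0, 0)); rewrite size_map size_iota subSS subn0 // => nu nus.
  rewrite (nth_map 0) ?size_iota ?subSS ?subn0 // nth_iota ?subSS ?subn0 //=.
  have -> : (s + 1 - (1 + nu)).-1 = s - nu.+1 by lia.
  rewrite (nth_map (0, 0)) ?size_cat; try lia.
  rewrite (nth_map (0, 0)) ?size_cat ?size_rev; try lia.
  rewrite !nth_cat size_rev nus; have -> : s - nu.+1 < size L1 by lia.
  rewrite nth_rev; last by lia.
  have -> : size L1 - (s - nu.+1).+1 = nu by lia.
  by rewrite -surjective_pairing.
- apply: (@eq_from_nth _ (0, 0)); rewrite size_map size_iota subSS addKn // => nu nus.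
  rewrite (nth_map 0) ?size_iota ?subSS ?addKn // nth_iota ?subSS ?addKn //=.
  rewrite (nth_map (0, 0)) ?size_cat; try lia.
  rewrite (nth_map (0, 0)) ?size_cat ?size_rev; try lia.
  rewrite !nth_cat size_rev.
  have -> : s + nu < size L1 = false by lia.
  have -> : ((t + s + 1 - (s.+1 + nu)).-1 < size L1) = false by lia.
  rewrite nth_rev; last by lia.
  have -> : size L0 - ((t + s + 1 - (s.+1 + nu)).-1 - size L1).+1 = nu by lia.
  have -> : s + nu - size L1 = nu by lia.
  by rewrite -surjective_pairing.
Qed.

(** For s = 0 and r = 1 these are the triples of an initial condition. *)
Lemma staircase_incomparable l m t s r i j : s <= t ->
  admissible_indices l m t i j ->
  incomparable ([seq (i nu, j (s + 1 - nu), r.+1) | nu <- index_iota 1 s.+1] ++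
    [seq (i nu, j (t + s + 1 - nu), r) | nu <- index_iota s.+1 t.+1]).
Proof.
move=> st [_ mono] v w; rewrite !mem_cat => /orP[]/mapP[mu] + -> /orP[]/mapP[nu] + ->;
  rewrite !mem_index_iota /precedes => mub nub.
- have [lemn|lenm] := leqP mu nu.
    have [] := mono mu nu; have [] := mono (s+1-nu) (s+1-mu); lia.
  have [] := mono nu mu; have [] := mono (s+1-mu) (s+1-nu); lia.
- have [] := mono mu nu; have [] := mono (s+1-mu) (t+s+1-nu); lia.
- have [] := mono nu mu; have [] := mono (s+1-nu) (t+s+1-mu); lia.
- have [lemn|lenm] := leqP mu nu.
    have [] := mono mu nu; have [] := mono (t+s+1-nu) (t+s+1-mu); lia.
  have [] := mono nu mu; have [] := mono (t+s+1-mu) (t+s+1-nu); lia.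
Qed.

(** * Colors as pairs of indices *)

(** The sum of simple roots telescopes. *)
Lemma colorE l i j : 0 < i -> i <= j.+1 ->
  color l i j = (delta_mx ord0 (inord i.-1) - delta_mx ord0 (inord j))%R.
Proof.
case: i => // i _; rewrite ltnS /color /=; elim: j => [|j IHj].
  by rewrite leqn0 => /eqP->; rewrite big_geq ?GRing.subrr.
rewrite leq_eqVlt => /predU1P[->|ltij]; first by rewrite big_geq ?GRing.subrr.
by rewrite big_nat_recr //= IHj // GRing.subrKA.
Qed.

Lemma color_inj l i j i' j' :
  0 < i <= j -> j <= l -> 0 < i' <= j' -> j' <= l ->
  color l i j = color l i' j' -> (i, j) = (i', j').
Proof.
move=> /andP[i0 ij] jl /andP[i0' ij'] jl'; rewrite !colorE ?leqW // => /matrixP E.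
have inordE a b : a <= l -> b <= l -> (@inord l a == inord b) = (a == b).
  by move=> al bl; rewrite -val_eqE /= !inordK.
(* A color has its entry 1 in column i - 1 and its entry -1 in column j. *)
have ltij : (i.-1 == j) = false by lia.
have ltji : (j == i.-1) = false by lia.
have := E ord0 (inord j); have := E ord0 (inord i.-1).
rewrite !mxE !inordE ?eqxx ?ltij ?ltji /=; try lia.
case: (i.-1 =P _) => [ii'|_]; case: (i.-1 =P _) => // _.
case: (j =P _) => [ji'|_]; case: (j =P _) => // <- _ _; last by congr pair; lia.
Qed.

Lemma uniq_colors l m (L : seq (nat * nat)) :
  {in L, forall a, in_grid l m a} ->
  uniq L -> uniq [seq color l a.1 a.2 | a <- L].
Proof.
move=> range uniqL; rewrite map_inj_in_uniq // => -[i j] [i' j'] /range + /range.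
by rewrite /in_grid /= => H1 H2 E; apply: color_inj E; lia.
Qed.

Lemma uniq_triples l (r a b : nat) (i j : nat -> nat) :
  uniq [seq color l (i nu) (j nu) | nu <- index_iota a b] ->
  uniq [seq (i nu, j nu, r) | nu <- index_iota a b].
Proof.
rewrite (map_comp (fun v => color l v.1.1 v.1.2) (fun nu => (i nu, j nu, r))).
exact: map_uniq.
Qed.

(** * Bounds on incomparable sets of variables *)

Definition mult l m (pi : monomial l m) (v : nat * nat * nat) : nat :=
  expo pi v.1.1 v.1.2 v.2.

(** In one degree, triples incomparable for [precedes] are comparable for
    [grid_le], so sorting makes a chain when V is incomparable. *)
Definition layer (V : seq (nat * nat * nat)) (d : nat) : seq (nat * nat) :=
  sort grid_le (undup [seq v.1 | v <- V & v.2 == d]).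

Lemma mem_layer V d a : (a \in layer V d) = ((a, d) \in V).
Proof.
rewrite mem_sort mem_undup; apply/mapP/idP => [[[b e]] | adV].
  by rewrite mem_filter => /andP[/eqP/= -> bV] ->.
by exists (a, d); rewrite // mem_filter eqxx.
Qed.

Lemma layer_uniq V d : uniq (layer V d).
Proof. by rewrite sort_uniq undup_uniq. Qed.

Lemma layer_chain V d : incomparable V -> pairwise grid_le (layer V d).
Proof.
move=> incV; rewrite -(sorted_pairwise grid_le_trans).
apply: (@sort_sorted_in _ [in layer V d]); last first.
  by apply/allP => a; rewrite -(mem_sort grid_le).
move=> [i j] [i' j']; rewrite /= !mem_layer => aV bV.
by have := incV _ _ aV bV; have := incV _ _ bV aV; rewrite /precedes /grid_le /=; lia.
Qed.

Lemma layers_cross V r : incomparable V ->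
  allrel cross (layer V r.+1) (layer V r).
Proof.
move=> incV; apply/allrelP => -[i j] [i' j']; rewrite !mem_layer => aV bV.
by have := incV _ _ bV aV; rewrite /precedes /cross /=; lia.
Qed.

Lemma difference_chains l m (Lam : dominant_weight l) (pi : monomial l m) r
    (L1 L0 : seq (nat * nat)) :
  difference_conditions Lam pi -> 0 < r -> uniq L1 -> uniq L0 ->
  {in L1 ++ L0, forall a, in_grid l m a} ->
  pairwise grid_le L1 -> pairwise grid_le L0 ->
  allrel cross L1 L0 ->
  \sum_(a <- L1) expo pi a.1 a.2 r.+1 + \sum_(a <- L0) expo pi a.1 a.2 r
    <= level Lam.
Proof.
move=> hdiff r_gt0 uL1 uL0 range pw1 pw0 pw10.
have [t0|t_gt0] := posnP (size L1 + size L0).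
  have -> : L1 = [::] by apply/nilP; rewrite /nilp; lia.
  have -> : L0 = [::] by apply/nilP; rewrite /nilp; lia.
  by rewrite !big_nil.
have [i [j [adm e1 e0]]] := staircase_indices range pw1 pw0 pw10.
have range1 a : a \in L1 -> in_grid l m a.
  by move=> aL; apply: range; rewrite mem_cat aL.
have range0 a : a \in L0 -> in_grid l m a.
  by move=> aL; apply: range; rewrite mem_cat aL orbT.
have u1 := uniq_colors range1 uL1; rewrite -e1 -map_comp in u1.
have u0 := uniq_colors range0 uL0; rewrite -e0 -map_comp in u0.
apply: leq_trans (hdiff r _ _ i j r_gt0 t_gt0 (leq_addr _ _) adm u1 u0).
by rewrite -{1}e1 -{1}e0 !big_map.
Qed.

Lemma initial_chain l m (Lam : dominant_weight l) (pi : monomial l m)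
    (L : seq (nat * nat)) :
  initial_conditions Lam pi -> uniq L -> L != [::] ->
  {in L, forall a, in_grid l m a} ->
  pairwise grid_le L ->
  exists a b, [/\ a \in L, b \in L &
    \sum_(a <- L) expo pi a.1 a.2 1 <=
      \sum_(q < l.+1 | q < a.1) Lam q + \sum_(q < l.+1 | b.2 < q) Lam q].
Proof.
move=> hinit uL L0 range pwL.
have range' a : a \in L ++ [::] -> in_grid l m a.
  by rewrite cats0; apply: range.
have [i [j]] := staircase_indices range' pwL isT (allrel0r _ _).
rewrite addn0; set t := size L => -[adm e _].
have t_gt0 : 0 < t by rewrite /t lt0n size_eq0.
have u := uniq_colors range uL; rewrite -e -map_comp in u.
have inL nu : 0 < nu <= t -> (i nu, j (t + 1 - nu)) \in L.
  move=> nut; rewrite -e; apply/mapP; exists nu => //.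
  by rewrite mem_index_iota ltnS.
exists (i t, j 1), (i 1, j t); split.
- by have := inL t; rewrite addKn; apply; rewrite t_gt0 leqnn.
- by have := inL 1; rewrite addnK; apply.
- by rewrite -{1}e big_map; apply: hinit u.
Qed.

(** The difference conditions in terms of the order: any incomparable set of
    variables that lies in two consecutive degrees consists of two chains as in
    [difference_chains], its layers. *)
Lemma difference_bound l m (Lam : dominant_weight l) (pi : monomial l m) V r :
  difference_conditions Lam pi -> 0 < r -> uniq V -> incomparable V ->
  {in V, forall v, is_generator l m v /\ (v.2 = r \/ v.2 = r.+1)} ->
  \sum_(v <- V) mult pi v <= level Lam.
Proof.
move=> hdiff r_gt0 uniqV incV genV.
have -> : \sum_(v <- V) mult pi v =
    \sum_(v <- [seq (a, r.+1) | a <- layer V r.+1] ++ [seq (a, r) | a <- layer V r])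
      mult pi v.
  apply/perm_big/uniq_perm => //.
    rewrite cat_uniq !map_inj_uniq ?layer_uniq ?andbT; try by move=> a b [].
    by apply/hasPn => _ /mapP[a _ ->]; apply/mapP => -[b _ []]; lia.
  move=> v; rewrite mem_cat; apply/idP/orP => [vV | [] /mapP[a]].
  - have [_ [vr|vr]] := genV v vV; [right|left];
      apply/mapP; exists v.1; rewrite ?mem_layer -?vr -?surjective_pairing //.
  - by rewrite mem_layer => ? ->.
  - by rewrite mem_layer => ? ->.
rewrite big_cat !big_map.
apply: difference_chains => //.
- exact: layer_uniq.
- exact: layer_uniq.
- case=> i j; rewrite mem_cat !mem_layer => /orP[] /genV[+ _];
  by rewrite /is_generator /in_grid /=; lia.
- exact: layer_chain.
- exact: layer_chain.
- exact: layers_cross.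
Qed.

(** The initial conditions in terms of the order; v has the largest first index
    and w the smallest second index in V. *)
Lemma initial_bound l m (Lam : dominant_weight l) (pi : monomial l m) V :
  initial_conditions Lam pi -> uniq V -> V != [::] -> incomparable V ->
  {in V, forall v, is_generator l m v /\ v.2 = 1} ->
  exists v w, [/\ v \in V, w \in V &
    \sum_(v <- V) mult pi v <=
      \sum_(q < l.+1 | q < v.1.1) Lam q + \sum_(q < l.+1 | w.1.2 < q) Lam q].
Proof.
move=> hinit uniqV V0 incV genV.
have VE : V =i [seq (a, 1) | a <- layer V 1].
  move=> v; apply/idP/mapP => [vV | [a]]; last by rewrite mem_layer => ? ->.
  have [_ v1] := genV v vV.
  by exists v.1; rewrite ?mem_layer -v1 -surjective_pairing.
have -> : \sum_(v <- V) mult pi v = \sum_(v <- [seq (a, 1) | a <- layer V 1]) mult pi v.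
  apply/perm_big/uniq_perm => //.
  by rewrite map_inj_uniq ?layer_uniq // => a b [].
have [||||a [b [aL bL le_sum]]] := @initial_chain l m Lam pi (layer V 1) hinit.
- exact: layer_uniq.
- apply: contraNneq V0 => L0; apply/eqP; case VE' : {1}V => [//|v s].
  by have := VE v; rewrite L0 VE' mem_head.
- by case=> i j; rewrite mem_layer => /genV[+ _]; rewrite /is_generator /in_grid /=; lia.
- exact: layer_chain.
exists (a, 1), (b, 1); rewrite -!mem_layer; split=> //.
by rewrite big_map.
Qed.

(** * Monomials as families of variables *)

Lemma expo_count l m (pi : monomial l m) (T : finType) (gen : T -> generator l m)
    (S : pred T) :
  (forall g, pi g = #|[set y | S y && (gen y == g)]|) ->
  forall i j r, expo pi i j r = #|[set y | S y && (val (gen y) == (i, j, r))]|.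
Proof.
move=> piE i j r; rewrite /expo; case: insubP => [g _ gE | not_gen].
  by rewrite piE; apply: eq_card => y; rewrite !inE -gE val_eqE.
apply/esym/eqP; rewrite cards_eq0; apply/eqP/setP => y; rewrite !inE.
apply/andP => -[_ /eqP genE]; case/negP: not_gen; rewrite -genE; exact: valP.
Qed.

(** Counting with multiplicities in a monomial amounts to counting elements of S
    when the monomial is the product of the gen y for y in S. *)
Lemma sum_mult l m (pi : monomial l m) (T : finType)
    (gen : T -> generator l m) (S : pred T) (V : seq (nat * nat * nat)) :
  (forall g, pi g = #|[set y | S y && (gen y == g)]|) -> uniq V ->
  \sum_(v <- V) mult pi v = #|[set y | S y && (val (gen y) \in V)]|.
Proof.
move=> piE uniqV; rewrite -sum1dep_card [RHS]big_mkcond /=.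
under eq_bigr => v _.
  rewrite /mult (expo_count piE) -sum1dep_card big_mkcond /=; over.
rewrite exchange_big /=; apply: eq_bigr => y _; case: (S y) => /=; last by rewrite big1.
rewrite -big_mkcond /= sum1_count.
transitivity (val (gen y) \in V : nat); last by case: (_ \in _).
rewrite -(count_uniq_mem _ uniqV).
by apply: eq_count => -[[i j] r] /=; rewrite eq_sym.
Qed.

(** Each variable is repeated as often as its exponent says, so that a statement
    about cardinalities in T takes exponents into account. *)
Lemma monomial_copies l m (pi : monomial l m) :
  exists (T : finType) (gen : T -> generator l m),
    forall g, pi g = #|[set y | gen y == g]|.
Proof.
exists {g : finsupp (cmonom_val pi) & 'I_(pi (val g))}, (fun y => val (tag y)) => g.
rewrite -sum1dep_card.
transitivity (\sum_(i : finsupp (cmonom_val pi) | val i == g) \sum_(j < pi (val i)) 1); last first.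
  by rewrite sig_big_dep; apply: eq_bigl => y; rewrite andbT.
under eq_bigr => i _ do rewrite sum1_card card_ord.
have [gpi|] := boolP (g \in finsupp (cmonom_val pi)).
  by rewrite (big_pred1 [` gpi]%fset) // => i; rewrite -val_eqE.
rewrite -cmE_eq0 => /eqP g0; rewrite g0 big1 // => i /eqP iE.
by rewrite iE.
Qed.

Lemma prod_ucmE (I : choiceType) (T : finType) (P : pred T) (F : T -> I) g :
  (\big[mmul/mone]_(y | P y) ucm (F y) : cmonom I) g = #|[set y | P y && (F y == g)]|.
Proof.
rewrite (big_morph (fun m : cmonom I => m g) (cmM g) (cm1 g)).
rewrite -sum1dep_card [RHS]big_mkcondr; apply: eq_bigr => y _ /=.
by rewrite cmU; case: (_ == _).
Qed.

Lemma x_monomial_prod (R : realType) l m (T : finType) (F : T -> monomial l m) :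
  x_monomial R (\big[mmul/mone]_(n : T) F n) = (\prod_(n : T) x_monomial R (F n))%R.
Proof.
apply: (big_morph (@x_monomial R l m)) => // a b.
by rewrite /x_monomial malgM_def fgmulUU GRing.mulr1.
Qed.

(** * Levels and fundamental weights *)

Lemma sum_fundamental l (q0 : 'I_l.+1) (P : pred 'I_l.+1) :
  \sum_(q < l.+1 | P q) fundamental_weight q0 q = P q0.
Proof.
have [Pq0|NPq0] := boolP (P q0); last first.
  rewrite big1 // => q Pq; rewrite ffunE; apply/eqP; rewrite eqb0.
  by apply: contraNneq NPq0 => <-.
rewrite (bigD1 q0) //= ffunE eqxx big1 ?addn0 // => q /andP[_ /negPf q'q].
by rewrite ffunE q'q.
Qed.

Lemma level_fundamental l (q : 'I_l.+1) : level (fundamental_weight q) = 1.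
Proof. exact: (sum_fundamental q predT). Qed.

Lemma sum_weight l k (p : 'I_k -> 'I_l.+1) (Lam : dominant_weight l) :
  Lam = (\sum_(n < k) fundamental_weight (p n))%R ->
  forall P : pred 'I_l.+1, \sum_(q < l.+1 | P q) Lam q = \sum_(n < k) P (p n).
Proof.
move=> LamE P.
rewrite (eq_bigr (fun q => \sum_(n < k) fundamental_weight (p n) q)) => [|q _].
  by rewrite exchange_big; apply: eq_bigr => n _; apply: sum_fundamental.
by rewrite LamE; apply: sum_ffunE.
Qed.

(** * The width of the poset of variables *)

Lemma three_zones a b c : a <= b -> (c < a) + (b < c) + (a <= c <= b) <= 1.
Proof. by case: (ltnP c a); case: (ltnP b c) => /=; lia. Qed.

Section Width.

Variables (l m k : nat) (Lam : dominant_weight l) (p : 'I_k -> 'I_l.+1).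
Variables (pi : monomial l m) (T : finType) (gen : T -> generator l m).
Hypotheses (levelE : level Lam = k)
  (LamE : Lam = (\sum_(n < k) fundamental_weight (p n))%R)
  (piE : forall g, pi g = #|[set y | gen y == g]|)
  (hdiff : difference_conditions Lam pi) (hinit : initial_conditions Lam pi).

Definition position (x : 'I_k + T) : nat * nat * nat :=
  match x with inl n => fictitious m (p n) | inr y => val (gen y) end.

Definition position_lt (x y : 'I_k + T) := precedes (position x) (position y).

Lemma generator_degree y : 0 < (val (gen y)).2.
Proof. by case: (gen y) => -[[i j] r] /= /and5P[]. Qed.

(** If r is the least degree in an antichain, all its degrees are r or r + 1. For
    r > 0 the difference conditions bound its size. For r = 0 and largest first
    index i and smallest second index j in degree 1, the fictitious variables in
    it are attached to nodes between i and j, while the initial condition bounds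
    the rest by the number of those attached to nodes outside this interval. *)
Lemma antichain_width (A : {set 'I_k + T}) : antichain position_lt A -> #|A| <= k.
Proof.
move=> /antichainP acA; have [->|[x0 x0A]] := set_0Vmem A; first by rewrite cards0.
have [a aA mina] := arg_minnP (fun x => (position x).2) x0A.
set r := (position a).2 in mina.
have deg x : x \in A -> (position x).2 = r \/ (position x).2 = r.+1.
  move=> xA; have := mina x xA; have := acA a x aA xA; rewrite /position_lt /r.
  by case: (position a) (position x) => [[? ?] ?] [[? ?] ?] /=; lia.
pose V := undup [seq val (gen y) | y <- enum T & inr y \in A].
have memV y : inr y \in A -> val (gen y) \in V.
  by move=> yA; rewrite mem_undup; apply/mapP; exists y; rewrite // mem_filter yA mem_enum.
have inV v : v \in V -> exists2 y, inr y \in A & v = val (gen y).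
  by rewrite mem_undup => /mapP[y]; rewrite mem_filter => /andP[yA _] ->; exists y.
have uniqV : uniq V := undup_uniq _.
have incV : incomparable V.
  by move=> _ _ /inV[x xA ->] /inV[y yA ->]; apply: acA xA yA.
have sumV : \sum_(v <- V) mult pi v = #|[set y | val (gen y) \in V]|.
  exact: (sum_mult (S := predT)).
pose gensA := @inr 'I_k T @: [set y | val (gen y) \in V].
have inr_inj : injective (@inr 'I_k T) by move=> x y [].
have inl_inj : injective (@inl 'I_k T) by move=> x y [].
have [r0|r_gt0] := posnP r; last first.
  have sAV : A \subset gensA.
    apply/subsetP => -[n|y] xA; last by rewrite imset_f // inE memV.
    by have := mina _ xA; rewrite leqNgt r_gt0.
  apply: leq_trans (subset_leq_card sAV) _.
  rewrite card_imset // -sumV -levelE; apply: difference_bound hdiff r_gt0 uniqV incV _.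
  by move=> _ /inV[y yA ->]; split; [apply: valP | apply: deg yA].
have degV : {in V, forall v, is_generator l m v /\ v.2 = 1}.
  move=> _ /inV[y yA ->]; split; first exact: valP.
  by have := generator_degree y; case: (deg _ yA) => /= ->; rewrite r0.
have [V0|Vn0] := eqVneq V [::].
  suff sA : A \subset @inl 'I_k T @: 'I_k.
    by rewrite (leq_trans (subset_leq_card sA)) // card_imset // card_ord.
  apply/subsetP => -[n|y] xA; first by rewrite imset_f.
  by have := memV y xA; rewrite V0.
have [v [w [vV wV le_sum]]] := initial_bound hinit uniqV Vn0 incV degV.
pose mid := [set n | v.1.1 <= p n <= w.1.2].
have sA : A \subset gensA :|: (@inl 'I_k T @: mid).
  apply/subsetP => -[n|y] xA; rewrite inE; last by rewrite imset_f // inE memV.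
  apply/orP; right; rewrite imset_f // inE.
  have [x yA vE] := inV v vV; have [z zA wE] := inV w wV.
  have := acA _ _ xA yA; have := acA _ _ xA zA.
  have [+ _] := degV v vV; have [+ _] := degV w wV.
  rewrite /position_lt /= -vE -wE /fictitious.
  case: (degV v vV) (degV w wV) => _ + [_ +].
  by case: (v) (w) => [[? ?] ?] [[? ?] ?] /= -> ->; lia.
apply: leq_trans (subset_leq_card sA) _.
apply: leq_trans (leq_card_setU _ _) _; rewrite !card_imset // -sumV.
apply: leq_trans (leq_add le_sum (leqnn _)) _; rewrite !(sum_weight LamE).
have -> : #|mid| = \sum_(n < k) (v.1.1 <= p n <= w.1.2).
  by rewrite -sum1dep_card big_mkcond; apply: eq_bigr => n _; case: ifP.
rewrite -!big_split /= -[leqRHS]card_ord -sum1_card; apply: leq_sum => n _.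
have : v.1.1 <= w.1.2.
  case: (degV v vV) (degV w wV) => + _ [+ _].
  by case: (v) (w) => [[? ?] ?] [[? ?] ?]; rewrite /is_generator /=; lia.
exact: three_zones.
Qed.

End Width.

(** * The factors *)

Section Factor.

Variables (l m : nat) (T : finType) (gen : T -> generator l m) (S : pred T).
Hypothesis chainS :
  {in S &, forall x y, [|| x == y, precedes (val (gen x)) (val (gen y))
                         | precedes (val (gen y)) (val (gen x))]}.

Variable pi : monomial l m.
Hypothesis piE : forall g, pi g = #|[set y | S y && (gen y == g)]|.

(** A chain and an antichain have at most one common element. *)
Lemma chain_clique V : uniq V -> incomparable V -> \sum_(v <- V) mult pi v <= 1.
Proof.
move=> uniqV incV; rewrite (sum_mult piE uniqV).
apply/card_le1_eqP => x y; rewrite !inE => /andP[Sx xV] /andP[Sy yV].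
have := chainS Sx Sy.
by rewrite (negPf (incV _ _ xV yV)) (negPf (incV _ _ yV xV)) !orbF => /eqP.
Qed.

Lemma chain_difference q : difference_conditions (fundamental_weight q) pi.
Proof.
move=> r t s i j r_gt0 t_gt0 st adm u1 u0; rewrite level_fundamental.
have incV := staircase_incomparable (r := r) st adm.
set V := _ ++ _ in incV.
have <- : \sum_(v <- V) mult pi v = \sum_(1 <= nu < s.+1) expo pi (i nu) (j (s + 1 - nu)) r.+1
     + \sum_(s.+1 <= nu < t.+1) expo pi (i nu) (j (t + s + 1 - nu)) r.
  by rewrite big_cat !big_map.
apply: chain_clique => //.
rewrite cat_uniq (uniq_triples (j := fun nu => j (s + 1 - nu)) _ u1).
rewrite (uniq_triples (j := fun nu => j (t + s + 1 - nu)) _ u0) andbT.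
by apply/hasPn => _ /mapP[nu _ ->]; apply/mapP => -[nu' _ []]; lia.
Qed.

(** If i_t <= q <= j_t, the right-hand side is 0, and every variable on the
    left-hand side is incomparable to the fictitious one, so not in its chain.
    Otherwise the right-hand side is at least 1. *)
Lemma chain_initial (q : 'I_l.+1) :
  {in S, forall y, precedes (fictitious m q) (val (gen y))
                || precedes (val (gen y)) (fictitious m q)} ->
  initial_conditions (fundamental_weight q) pi.
Proof.
move=> chainq t i j t_gt0 adm u1; rewrite !sum_fundamental.
(* The triples are those of a difference condition with s = 0, whose second
   index is written j (t + 0 + 1 - nu). *)
have incV := staircase_incomparable (r := 1) (leq0n t) adm.
rewrite [index_iota 1 1]/= cat0s in incV.
set V := map _ _ in incV.
have uniqV : uniq V.
  by apply: (@uniq_triples l 1 _ _ i (fun nu => j (t + 0 + 1 - nu))); rewrite addn0.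
have -> : \sum_(1 <= nu < t.+1) expo pi (i nu) (j (t + 1 - nu)) 1 = \sum_(v <- V) mult pi v.
  by rewrite big_map addn0.
have [lt_i|le_i] := ltnP q (i t); first by rewrite (leq_trans (chain_clique uniqV incV)).
have [lt_j|le_j] := ltnP (j t) q; first by rewrite (leq_trans (chain_clique uniqV incV)).
rewrite (sum_mult piE uniqV) leqn0 cards_eq0; apply/eqP/setP => y; rewrite !inE.
apply/andP => -[Sy /mapP[nu]]; rewrite mem_index_iota ltnS => nut yE.
have := chainq y Sy; rewrite yE /fictitious /precedes.
have [range mono] := adm.
have [|||i_nu _] := mono nu t; try lia.
have [|||_ j_nu] := mono (t + 0 + 1 - nu) t; try lia.
have [|rt _] := range nu; first by lia.
by have [|_ rj] := range (t + 0 + 1 - nu); lia.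
Qed.

End Factor.

Local Open Scope ring_scope.

Theorem theorem4 (R : realType) (l m : nat) (hm : (1 <= m <= l)%N) (k : nat)
    (Lam : dominant_weight l) (hlevel : level Lam = k)
    (p : 'I_k -> 'I_l.+1)
    (hLam : Lam = \sum_(n < k) fundamental_weight (p n))
    (pi : monomial l m)
    (hdiff : difference_conditions Lam pi)
    (hinit : initial_conditions Lam pi) :
  exists pis : 'I_k -> monomial l m,
    x_monomial R pi = \prod_(n < k) x_monomial R (pis n) /\
    forall n : 'I_k,
      difference_conditions (fundamental_weight (p n)) (pis n) /\
      initial_conditions (fundamental_weight (p n)) (pis n).
Proof.
have [T [gen piE]] := monomial_copies pi.
have lt_irr : irreflexive (position_lt p gen) by move=> x; apply: precedes_irr.
have lt_trans : transitive (position_lt p gen) by move=> y x z; apply: precedes_trans.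
have [A _|f fcol] := dilworth lt_irr lt_trans (k := k) (P := setT).
  exact: antichain_width hlevel hLam piE hdiff hinit A.
have [f_lt f_chain] := fcol.
(* Each chain contains exactly one fictitious variable. *)
pose B : {set 'I_k + T} := @inl 'I_k T @: 'I_k.
have inl_inj : injective (@inl 'I_k T) by move=> x y [].
have acB : antichain (position_lt p gen) B.
  apply/antichainP => _ _ /imsetP[n _ ->] /imsetP[n' _ ->].
  by rewrite /position_lt /=; lia.
have cardB : #|B| = k by rewrite card_imset // card_ord.
have color_node y : exists n, f (inr y) = f (inl n).
  have [x] := antichain_meets_chains fcol (subsetT B) acB cardB (f_lt (inr y) (in_setT _)).
  by case/imsetP => n _ -> fn; exists n.
have f_inl n n' : f (inl n) = f (inl n') -> n = n'.
  move=> fE; have := f_chain _ _ (in_setT _) (in_setT _) fE.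
  move/antichainP: acB => acB.
  rewrite (negPf (acB _ _ _ _)) ?imset_f // (negPf (acB _ _ _ _)) ?imset_f // !orbF.
  by case/eqP.
pose pis n : monomial l m := \big[mmul/mone]_(y | f (inr y) == f (inl n)) ucm (gen y).
exists pis; split.
  rewrite -x_monomial_prod; congr x_monomial.
  rewrite (exchange_big_dep predT) //=; apply/eqP/cmP => g.
  transitivity ((\big[mmul/mone]_y ucm (gen y) : monomial l m) g).
    by rewrite prod_ucmE piE.
  congr (cmonom_val _ _); apply: eq_bigr => y _; have [n fn] := color_node y.
  rewrite (big_pred1 n) // => n'; rewrite fn; apply/eqP/eqP => [/f_inl->|->] //.
move=> n; have pisE g : pis n g = #|[set y | (f (inr y) == f (inl n)) && (gen y == g)]|.
  exact: prod_ucmE.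
have chainS : {in [pred y | f (inr y) == f (inl n)] &,
    forall x y, [|| x == y, precedes (val (gen x)) (val (gen y))
                         | precedes (val (gen y)) (val (gen x))]}.
  move=> x y /eqP fx /eqP fy.
  by have := f_chain _ _ (in_setT _) (in_setT _) (etrans fx (esym fy)).
split; first exact: chain_difference chainS _ pisE _.
apply: chain_initial chainS _ pisE _ _ => y /eqP fy.
by have := f_chain _ _ (in_setT _) (in_setT _) (esym fy).
Qed.
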